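(* Let $F$ be a forest on $n$ vertices with $C$ connected components. Then $I_s(F) \geq \frac{5n+3C}{13}$.
   Context: The competition-independence game on a graph $G$ is played by two players, Sweller and Diminisher, who alternately choose a vertex of $G$ not adjacent to (and distinct from) any previously chosen vertex, until no such vertex exists; the chosen set is then a maximal independent set of $G$. Sweller wants the final set to be as large as possible, Diminisher as small as possible. $I_s(G)$ denotes the size of the final set (equivalently, the number of moves) when Sweller moves first and both players play optimally. *)

(* Defs.v *)
From mathcomp Require Import all_boot all_order all_algebra.

Set Implicit Arguments.
Unset Strict Implicit.
Unset Printing Implicit Defensive.

(* A simple graph on the vertex set T is a symmetric irreflexive e : rel T. *)
(* An edge {x, y} gives the ucycle [:: x; y] of size 2, so the graph cycles  *)
(* are exactly the ucycles of size at least 3.                               *)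
Definition acyclic (T : finType) (e : rel T) : Prop :=
  forall c : seq T, ucycle e c -> size c <= 2.

Definition num_components (T : finType) (e : rel T) : nat := n_comp e predT.

Section CompetitionIndependence.

Variables (T : finType) (e : rel T).

Definition playable (S : {set T}) : {set T} :=
  [set v | (v \notin S) && [forall u in S, ~~ e u v]].

Variant player := Sweller | Diminisher.

(* Size of the final set under optimal play from the position S with p to    *)
(* move, by backward induction. The fuel k bounds the number of remaining    *)
(* moves; it is irrelevant once #|T| <= k + #|S| (see final_size_fuel). The  *)
(* default value #|T| of the minimum is an upper bound of all the values.    *)
Fixpoint final_size (k : nat) (p : player) (S : {set T}) : nat :=
  if k is k'.+1 then
    if playable S == set0 then #|S| else
    match p with
    | Sweller =>
        \max_(v in playable S) final_size k' Diminisher (v |: S)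
    | Diminisher =>
        \big[minn/#|T|]_(v in playable S) final_size k' Sweller (v |: S)
    end
  else #|S|.

Definition game_value (p : player) (S : {set T}) : nat := final_size #|T| p S.

Definition I_s : nat := game_value Sweller set0.

Lemma playable_card (S : {set T}) v :
  v \in playable S -> #|v |: S| = #|S|.+1.
Proof. by rewrite inE => /andP[vS _]; rewrite cardsU1 vS. Qed.

Lemma final_size_le k p (S : {set T}) : final_size k p S <= #|T|.
Proof.
elim: k p S => [|k IHk] p S /=; first exact: max_card.
case: ifP => _; first exact: max_card.
case: p; first by apply/bigmax_leqP => v _; exact: IHk.
by elim/big_rec: _ => // v m _ le_m; rewrite geq_min le_m orbT.
Qed.

Lemma final_size_fuel k l p (S : {set T}) :
  #|T| <= k + #|S| -> #|T| <= l + #|S| -> final_size k p S = final_size l p S.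
Proof.
have full m q (A : {set T}) : #|T| <= #|A| -> final_size m q A = #|A|.
  move=> leTA; case: m => //= m; suff -> : playable A = set0 by rewrite eqxx.
  apply/setP=> v; rewrite !inE; have /eqP -> : A == setT.
    by rewrite eqEcard subsetT cardsT.
  by rewrite inE.
elim: k l p S => [|k IHk] [|l] p S // lek lel; try by rewrite !full.
rewrite /=; case: ifP => // _.
have IH q v : v \in playable S ->
    final_size k q (v |: S) = final_size l q (v |: S).
  by move=> Sv; apply: IHk; rewrite playable_card // addnS -addSn.
by case: p => {lek lel}; apply: eq_bigr => v; exact: IH.
Qed.

Lemma game_valueE p (S : {set T}) :
  game_value p S =
    if playable S == set0 then #|S| else
    match p with
    | Sweller => \max_(v in playable S) game_value Diminisher (v |: S)
    | Diminisher =>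
        \big[minn/#|T|]_(v in playable S) game_value Sweller (v |: S)
    end.
Proof.
have /(final_size_fuel p) := leq_addr #|S| #|T|.
rewrite {1}/game_value => /(_ #|T|.+1) -> /=; last first.
  by rewrite addSn leqW // leq_addr.
by case: ifP => // _; case: p.
Qed.

(* The minimum is attained, so its default value plays no role. *)
Lemma game_value_minP (S : {set T}) : playable S != set0 ->
  exists2 v, v \in playable S &
    game_value Diminisher S = game_value Sweller (v |: S) /\
    forall w, w \in playable S ->
      game_value Sweller (v |: S) <= game_value Sweller (w |: S).
Proof.
case/set0Pn=> v0 Sv0; pose F w := game_value Sweller (w |: S).
have [v Sv minv] := @arg_minnP T v0 (mem (playable S)) F Sv0.
exists v => //; split; last exact: minv.
rewrite game_valueE; case: eqP => [S0|_]; first by rewrite S0 inE in Sv0.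
apply/eqP; rewrite eqn_leq; apply/andP; split.
  have: v \in index_enum T by rewrite mem_index_enum.
  elim: (index_enum T) => // w s IHs; rewrite inE big_cons.
  case/predU1P=> [<-|/IHs les]; first by rewrite ifT ?geq_minl.
  by case: ifP => // _; rewrite geq_min les orbT.
elim/big_rec: _ => [|w m Sw le_m]; first exact: final_size_le.
by rewrite leq_min le_m andbT; exact: minv.
Qed.

End CompetitionIndependence.

(* Main.v *)
Require Import Defs.
From mathcomp Require Import all_boot all_order all_algebra.
From mathcomp Require Import zify.
Import Order.TTheory GRing.Theory Num.Theory.
Local Open Scope ring_scope.

(** Let A be the set of playable vertices. Every vertex of A gets the weight
    16 - 3d if it has d > 0 neighbours in A, and 26 if it has none; in a forest
    with n vertices and C components the total weight is at least 10n + 6C,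
    since there are n - C edges. Sweller always has a move x after which every
    reply y satisfies: x and y together destroy at most weight 52, so the game
    lasts at least (total weight)/26 moves.

    Write [loss] for half the weight destroyed by a move, and let v be a
    vertex of maximal loss M. If M <= 13, Sweller plays any vertex of degree 1.
    If M > 13 and v has a neighbour u of degree 2 whose other neighbour is not
    a leaf, Sweller plays u; otherwise v has at least two leaves, and Sweller
    plays one of them. *)

Section Forest.

Set Implicit Arguments.
Unset Strict Implicit.

Variables (T : finType) (e : rel T).
Hypotheses (e_sym : symmetric e) (e_irr : irreflexive e) (e_forest : acyclic e).
Implicit Types (A S : {set T}) (x y z t p u v w : T).

(** * Short closed walks in a forest *)

Lemma edge_neq x y : e x y -> x != y.
Proof. by apply: contraTneq => ->; rewrite e_irr. Qed.

Lemma no_long_cycle (c : seq T) : (2 < size c)%N -> uniq c -> cycle e c -> False.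
Proof.
move=> lt2c Uc Cc; have := @e_forest c (introT andP (conj Cc Uc)).
by rewrite leqNgt lt2c.
Qed.

Lemma no_triangle x y z : e x y -> e y z -> e z x -> False.
Proof.
move=> xy yz zx; apply: (@no_long_cycle [:: x; y; z]); first by [].
  rewrite /= !inE !negb_or (edge_neq xy) (edge_neq yz).
  by rewrite eq_sym (edge_neq zx).
by rewrite /= xy yz zx.
Qed.

Lemma common_nbr_unique x y p q :
  x != y -> e x p -> e p y -> e x q -> e q y -> p = q.
Proof.
move=> neq_xy xp py xq qy; apply/eqP/negPn/negP => neq_pq.
apply: (@no_long_cycle [:: x; p; y; q]); first by [].
  rewrite /= !inE !negb_or neq_xy neq_pq (edge_neq xp) (edge_neq xq).
  by rewrite (edge_neq py) eq_sym (edge_neq qy).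
by rewrite /= xp py e_sym qy e_sym xq.
Qed.

(** If two non-consecutive vertices coincide, a triangle remains; otherwise this is a cycle of
    length 5. *)
Lemma no_pentagon x y z t u : e x y -> e y z -> e z t -> e t u -> e u x -> False.
Proof.
move=> xy yz zt tu ux; have [eq_xz|neq_xz] := eqVneq x z.
  by subst z; apply: (no_triangle zt tu ux).
have [eq_yt|neq_yt] := eqVneq y t.
  by subst t; apply: (no_triangle xy tu ux).
have [eq_zu|neq_zu] := eqVneq z u.
  by subst u; apply: (no_triangle xy yz ux).
have [eq_tx|neq_tx] := eqVneq t x.
  by subst t; apply: (no_triangle xy yz zt).
have [eq_uy|neq_uy] := eqVneq u y.
  by subst u; apply: (no_triangle yz zt tu).
apply: (@no_long_cycle [:: x; y; z; t; u]); first by [].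
  rewrite /= !inE !negb_or neq_xz neq_yt neq_zu ![x == _]eq_sym neq_tx.
  rewrite [y == u]eq_sym neq_uy [y == x]eq_sym.
  by rewrite (edge_neq xy) (edge_neq yz) (edge_neq zt) (edge_neq tu) (edge_neq ux).
by rewrite /= xy yz zt tu ux.
Qed.

(** Two such walks with [t], [t'] and [p], [p'] distinct would form a hexagon; sharing one inner
    vertex forces the other by [common_nbr_unique]. *)
Lemma walk3_unique x y t p t' p' :
  x != y -> ~~ e x y -> ~~ e x t -> x != t -> x != t' -> ~~ e x t' ->
  e y t -> e t p -> e p x -> e y t' -> e t' p' -> e p' x -> t = t' /\ p = p'.
Proof.
move=> neq_xy nxy nxt neq_xt neq_xt' nxt' yt tp px yt' tp' p'x.
have neq_px q w : ~~ e x w -> e q x -> w != q.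
  by move=> nxw qx; apply: contraNneq nxw => ->; rewrite e_sym.
have [eq_t|neq_t] := eqVneq t t'.
  subst t'; split=> //; apply: (@common_nbr_unique t x) => //.
  by rewrite eq_sym.
have [eq_p|neq_p] := eqVneq p p'.
  subst p'; split=> //; apply: (@common_nbr_unique y p) => //.
  exact: neq_px.
exfalso; apply: (@no_long_cycle [:: y; t; p; x; p'; t']); first by [].
  rewrite /= !inE !negb_or neq_t neq_p neq_xt' (edge_neq yt) (edge_neq yt').
  rewrite (edge_neq tp) (edge_neq px) ![_ == x]eq_sym neq_xy neq_xt.
  rewrite [x == p']eq_sym (edge_neq p'x) [p' == t']eq_sym (edge_neq tp').
  rewrite (neq_px p y) // (neq_px p' y) // (neq_px p' t) //.
  by rewrite [p == t']eq_sym (neq_px p t').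
by rewrite /= yt tp px e_sym p'x e_sym tp' e_sym yt'.
Qed.

(** * Degrees, weights and losses in an induced subgraph *)

Definition nbr A x : {set T} := [set y in A | e x y].
Definition deg A x : nat := #|nbr A x|.

(* Otherwise a path could be prolonged at its head forever. *)
Lemma exists_deg_le1 A : A != set0 -> exists2 x, x \in A & (deg A x <= 1)%N.
Proof.
move=> A0; have [/existsP[x /andP[xA dx]]|/existsPn degA] :=
  boolP [exists x, (x \in A) && (deg A x <= 1)%N]; first by exists x.
have long k : exists x (s : seq T),
    [/\ size s = k, uniq (x :: s), path e x s & x \in A].
  elim: k => [|k [x [s [sz_s Us ps xA]]]].
    by have /set0Pn[x xA] := A0; exists x, [::].
  have := degA x; rewrite xA -ltnNge /= => deg2.
  (* A neighbour of [x] other than its successor on the path; for empty [s] the default [x] is not a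
     neighbour of itself, so nothing is excluded. *)
  have /set0Pn[y] : nbr A x :\ head x s != set0.
    rewrite -card_gt0; move: deg2; rewrite /deg (cardsD1 (head x s)).
    by case: (_ \in _) => //=; lia.
  rewrite !inE => /and3P[y_head yA xy]; exists y, (x :: s).
  have [ys|nys] := boolP (y \in x :: s); last first.
    split=> //; first by rewrite /= sz_s.
    by rewrite /= e_sym xy.
  (* If [y] is already on the path, the segment from [x] to [y] closes up to a cycle, of length at
     least 3 because [y] is not the head of [s]. *)
  exfalso; move: ys; rewrite inE eq_sym (negPf (edge_neq xy)) /= => ys.
  case/splitPr: ys y_head Us ps {sz_s} => -[|z s1] s2; first by rewrite eqxx.
  move=> _ Us ps.
  apply: (@no_long_cycle (x :: z :: rcons s1 y)).
  - by rewrite /= size_rcons.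
  - move: Us; rewrite -cat_rcons -cat_cons.
    by rewrite cat_uniq => /andP[].
  move: ps; rewrite -cat_rcons cat_path => /andP[ps _].
  by rewrite /cycle rcons_path ps /= last_rcons e_sym xy.
have [x [s [sz_s Us _ _]]] := long #|T|.
by have := max_card (mem (x :: s)); rewrite (card_uniqP Us) /= sz_s ltnn.
Qed.

(* The leaves hanging on t that become isolated when x is played next to t. *)
Definition leaf_nbrs A x t : {set T} := [set z in nbr A t :\ x | deg A z == 1%N].

(** Half the weight destroyed on account of [t] when [x] is played: [t], of degree d, loses 16 - 3d;
    the edge to [x] accounts for -3 from the weight of [x]; each other neighbour of [t] gains 3, and
    10 more if it becomes isolated. *)
Definition contrib A x t : int := 8 - 3 * (deg A t)%:Z - 5 * #|leaf_nbrs A x t|%:Z.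

Definition loss A x : int :=
  8 + 5 * (deg A x == 0%N)%:Z + \sum_(t in nbr A x) contrib A x t.

Definition weight (k : nat) : int := 16 - 3 * k%:Z + 10 * (k == 0%N)%:Z.

Definition potential A : int := \sum_(y in A) weight (deg A y).

(** * The effect of a move on the remaining vertices *)

Definition rest A x : {set T} := A :\: (x |: nbr A x).

Lemma in_nbr A x y : (y \in nbr A x) = (y \in A) && e x y.
Proof. by rewrite inE. Qed.

Lemma in_rest A x y : (y \in rest A x) = [&& y != x, ~~ e x y & y \in A].
Proof.
rewrite !inE negb_or negb_and; case: (y \in A); last by rewrite !andbF.
by rewrite !andbT.
Qed.

Lemma nbr_rest A x y : y \in rest A x -> nbr (rest A x) y = nbr A y :\: nbr A x.
Proof.
rewrite in_rest => /and3P[neq_yx nxy yA]; apply/setP=> t.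
rewrite in_nbr in_rest in_setD !in_nbr.
have [->|_] /= := eqVneq t x; first by rewrite e_sym (negPf nxy) !andbF.
by case: (t \in A); rewrite ?andbF ?andbT.
Qed.

Lemma deg_rest A x y : y \in rest A x ->
  (deg (rest A x) y + #|nbr A y :&: nbr A x| = deg A y)%N.
Proof. by move=> yA; rewrite /deg nbr_rest // addnC cardsID. Qed.

Lemma card_common_nbr A x y : y != x -> (#|nbr A y :&: nbr A x| <= 1)%N.
Proof.
move=> neq_yx; apply/card_le1_eqP => p q; rewrite !inE.
move=> /andP[/andP[_ yp] /andP[_ xp]] /andP[/andP[_ yq] /andP[_ xq]].
by apply: (common_nbr_unique neq_yx) => //; rewrite e_sym.
Qed.

(** The sum has at most one term, since a survivor loses at most one neighbour: its weight then
    rises by 3, or from 13 to 26 if it was a leaf. The form as a sum allows the regrouping in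
    [potential_loss]. *)
Lemma weight_rest A x y : y \in rest A x ->
  weight (deg A y) - weight (deg (rest A x) y) =
  \sum_(t in nbr A y :&: nbr A x) (- 3 - 10 * (deg A y == 1%N)%:Z).
Proof.
move=> yA; have /and3P[neq_yx _ _] : [&& y != x, ~~ e x y & y \in A].
  by rewrite -in_rest.
rewrite sumr_const; have := deg_rest yA; have := card_common_nbr A neq_yx.
case: #|_| => [|[|//]] _; rewrite ?addn0 ?addn1 => <-; rewrite /weight ?mulr0n ?mulr1n.
  by rewrite subrr.
by rewrite eqSS /=; lia.
Qed.

Lemma sum_indicator A (P : pred T) :
  \sum_(t in A) (P t)%:Z = #|[set t in A | P t]|%:Z.
Proof.
rewrite -sum1_card -[RHS]natz natr_sum big_mkcond [RHS]big_mkcond /=.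
by apply: eq_bigr => t _; rewrite inE; case: (t \in A) => //=; case: (P t).
Qed.

Lemma potential_loss A x : x \in A ->
  potential A - potential (rest A x) = 2 * loss A x.
Proof.
move=> xA; rewrite /potential (big_setID (x |: nbr A x)) /= -/(rest A x).
have -> : A :&: (x |: nbr A x) = x |: nbr A x.
  by apply/setIidPr/subsetP => y; rewrite !inE => /predU1P[->|/andP[]].
rewrite big_setU1 /=; last by rewrite in_nbr e_irr andbF.
rewrite -[LHS]addrA -sumrB (eq_bigr _ (fun y => @weight_rest A x y)).
(* The gains of the survivors are regrouped by the destroyed neighbour [t] causing them. *)
rewrite (exchange_big_dep (mem (nbr A x))) /=; last first.
  by move=> y t _; rewrite inE => /andP[].
rewrite -addrA -big_split /= /loss mulrDr mulr_sumr.
have -> : weight (deg A x) =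
    2 * (8 + 5 * (deg A x == 0%N)%:Z) - \sum_(t in nbr A x) 3.
  by rewrite sumr_const -/(deg A x) /weight; lia.
rewrite -addrA -sumrN -big_split /=; congr (_ + _); apply: eq_bigr => t tx.
have [tA xt] : t \in A /\ e x t by apply/andP; rewrite -in_nbr.
(* Without triangles, every neighbour of [t] other than [x] survives. *)
have -> : \sum_(i in rest A x | t \in nbr A i :&: nbr A x)
    (- 3 - 10 * (deg A i == 1%N)%:Z) =
  \sum_(i in nbr A t :\ x) (- 3 - 10 * (deg A i == 1%N)%:Z).
  apply: eq_bigl => z; rewrite !inE tA xt andbT /=; rewrite [e z t]e_sym.
  have [->|_] //= := eqVneq z x.
  have [tz|] := boolP (e t z); rewrite ?andbF //= !andbT.
  have [xz|_] := boolP (e x z); last by rewrite andbF.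
  by case: (no_triangle xt tz); rewrite e_sym.
rewrite big_split /= sumr_const sumrN -mulr_sumr.
rewrite (sum_indicator _ (fun z => deg A z == 1%N)) -/(leaf_nbrs A x t).
rewrite /contrib; have -> : (deg A t = #|nbr A t :\ x|.+1)%N.
  by rewrite /deg (cardsD1 x) in_nbr xA e_sym xt.
by rewrite /weight /=; lia.
Qed.

(** A leaf at [t] other than [y] cannot be adjacent to [x] too, so it survives as a leaf; only the
    degree of [t] can drop, at a cost of 3 per lost neighbour. *)
Lemma contrib_rest A x y t : x \in A -> t \in nbr (rest A x) y ->
  contrib (rest A x) y t <= contrib A y t + 3 * #|nbr A t :&: nbr A x|%:Z.
Proof.
move=> xA; rewrite in_nbr => /andP[tA' yt]; have degt := deg_rest tA'.
have /and3P[neq_tx nxt tA] : [&& t != x, ~~ e x t & t \in A] by rewrite -in_rest.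
have /subset_leq_card : leaf_nbrs A y t \subset leaf_nbrs (rest A x) y t.
  apply/subsetP=> z; rewrite inE in_setD1 in_nbr.
  case/andP=> /and3P[neq_zy zA tz] /eqP degz.
  have nxz : ~~ e x z.
    apply/negP=> xz; have /subset_leq_card : [set x; t] \subset nbr A z.
      by apply/subsetP=> w /set2P[] ->; rewrite in_nbr ?xA ?tA e_sym.
    by rewrite cards2 eq_sym neq_tx -/(deg A z) degz.
  have zA' : z \in rest A x.
    rewrite in_rest nxz zA !andbT; apply: contraNneq nxt => <-.
    by rewrite e_sym.
  rewrite inE in_setD1 in_nbr neq_zy zA' tz /=.
  have := deg_rest zA'; rewrite degz.
  have : (0 < deg (rest A x) z)%N.
    by apply/card_gt0P; exists t; rewrite in_nbr tA' e_sym.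
  by clear; lia.
by rewrite /contrib; clear -degt; lia.
Qed.

Lemma loss_isolated A x : deg A x = 0%N -> loss A x = 13.
Proof.
by rewrite /loss => d0; rewrite d0 (cards0_eq d0) big_set0.
Qed.

(* The loss of y changes only through the unique short path from x to y: it may
   grow by 3 at distance 3, while at distance 2 the contribution of the middle
   vertex p disappears. *)
Lemma loss_rest A x y : x \in A -> y \in rest A x ->
  [\/ loss (rest A x) y <= 13,
      loss (rest A x) y <= loss A y,
      loss (rest A x) y <= loss A y + 3 /\
        exists2 p, p \in nbr A x & (1 < deg A p)%N
    | exists p, [/\ p \in nbr A x, y \in nbr A p, (1 < deg A y)%N &
        loss (rest A x) y <= loss A y - contrib A y p]].
Proof.
move=> xA yA'; have degy := deg_rest yA'.
have /and3P[neq_yx nxy yA] : [&& y != x, ~~ e x y & y \in A] by rewrite -in_rest.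
have [/loss_isolated ->|deg0] := eqVneq (deg (rest A x) y) 0%N.
  by constructor 1.
have lossE : loss (rest A x) y = 8 + \sum_(t in nbr (rest A x) y) contrib (rest A x) y t.
  by rewrite /loss (negPf deg0) mulr0 addr0.
have lossEA : loss A y = 8 + \sum_(t in nbr A y) contrib A y t.
  by rewrite /loss; have /negPf -> : deg A y != 0%N by lia; rewrite mulr0 addr0.
have nbrE := nbr_rest yA'.
have [/setP p0|[p]] := set_0Vmem (nbr A y :&: nbr A x); last first.
  rewrite in_setI => /andP[yp xp]; constructor 4; exists p.
  have [[pA ey] [_ ex]] : (p \in A /\ e y p) /\ (p \in A /\ e x p).
    by split; apply/andP; rewrite -in_nbr.
  have yxI : (0 < #|nbr A y :&: nbr A x|)%N.
    by apply/card_gt0P; exists p; rewrite in_setI yp.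
  split=> //; [by rewrite in_nbr yA e_sym | by clear -degy yxI deg0; lia |].
  (* At distance 2, [y] loses exactly [p]; a change at another neighbour [t] would give a closed
     walk of length 5. *)
  have nbrE' : nbr (rest A x) y = nbr A y :\ p.
    rewrite nbrE; apply/setP=> q; rewrite in_setD in_setD1 andbC [RHS]andbC.
    case yq: (q \in nbr A y) => //=; congr (~~ _); apply/idP/eqP => [xq|-> //].
    have /card_le1_eqP := card_common_nbr A neq_yx; apply; rewrite in_setI ?yp //.
    by rewrite yq.
  rewrite lossE lossEA [X in _ <= 8 + X - _](big_setD1 p) //= -nbrE'.
  have: \sum_(t in nbr (rest A x) y) contrib (rest A x) y t <=
        \sum_(t in nbr (rest A x) y) contrib A y t.
    apply: ler_sum => t yt; apply: le_trans (contrib_rest xA yt) _.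
    rewrite -[X in _ <= X]addr0 lerD2l; suff -> : nbr A t :&: nbr A x = set0.
      by rewrite cards0.
    apply/setP=> q; rewrite !inE; apply/negP=> /andP[/andP[_ tq] /andP[_ xq]].
    move: yt; rewrite in_nbr => /andP[_ yt].
    by apply: (no_pentagon yt tq _ ex); rewrite e_sym.
  by rewrite [contrib A y p + _]addrC addrA addrK lerD2l.
have {}nbrE : nbr (rest A x) y = nbr A y.
  by rewrite nbrE; apply/setDidPl; rewrite -setI_eq0; apply/eqP/setP.
(* Now [y] keeps all its neighbours. By [walk3_unique] at most one of them, [t], loses a neighbour
   [p], and [p] is adjacent to both [x] and [t]. *)
have [/exists_inP[t yt tx]|/exists_inPn no_t] :=
    boolP [exists t in nbr (rest A x) y, nbr A t :&: nbr A x != set0].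
  constructor 3.
  have [tA' ey] : t \in rest A x /\ e y t by apply/andP; rewrite -in_nbr.
  have /and3P[neq_tx nxt tA] : [&& t != x, ~~ e x t & t \in A] by rewrite -in_rest.
  have /set0Pn[p] := tx; rewrite in_setI !in_nbr => /andP[/andP[pA tp] /andP[_ xp]].
  split; last first.
    exists p; first by rewrite in_nbr pA.
    have /subset_leq_card : [set x; t] \subset nbr A p.
      by apply/subsetP=> w /set2P[] ->; rewrite in_nbr ?xA ?tA e_sym.
    by rewrite cards2 eq_sym neq_tx.
  rewrite lossE lossEA -nbrE (big_setD1 t) // [X in _ <= 8 + X + _](big_setD1 t) //=.
  have: \sum_(q in nbr (rest A x) y :\ t) contrib (rest A x) y q <=
        \sum_(q in nbr (rest A x) y :\ t) contrib A y q.
    apply: ler_sum => q; rewrite in_setD1 => /andP[neq_qt yq].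
    apply: le_trans (contrib_rest xA yq) _.
    rewrite -[X in _ <= X]addr0 lerD2l; suff -> : nbr A q :&: nbr A x = set0.
      by rewrite cards0.
    apply/setP=> r; rewrite !inE; apply/negP=> /andP[/andP[_ qr] /andP[_ xr]].
    move: yq; rewrite in_nbr in_rest => /andP[/and3P[neq_qx nxq _] yq].
    case: (@walk3_unique x y q r t p) neq_qt; rewrite 1?eq_sym // 1?e_sym //.
    by move=> -> _; rewrite eqxx.
  move=> le_sum; rewrite -[8 + _ + 3]addrA lerD2l [leRHS]addrAC; apply: lerD => //.
  apply: le_trans (contrib_rest xA yt) _; rewrite lerD2l.
  by have := card_common_nbr A neq_tx; case: #|_| => [|[|]].
constructor 2; rewrite lossE lossEA -nbrE lerD2l; apply: ler_sum => t yt.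
apply: le_trans (contrib_rest xA yt) _.
by have := no_t t yt; rewrite negbK => /eqP ->; rewrite cards0 mulr0 addr0.
Qed.

(** * Bounds on the loss in terms of degrees and leaves *)

Definition leaves A v : {set T} := [set t in nbr A v | deg A t == 1%N].

Lemma nbr_sym A x y : x \in A -> y \in nbr A x -> x \in nbr A y.
Proof. by move=> xA; rewrite !in_nbr xA e_sym => /andP[]. Qed.

Lemma deg_gt0 A x y : y \in nbr A x -> (0 < deg A x)%N.
Proof. by move=> yx; apply/card_gt0P; exists y. Qed.

Lemma contrib_nonleaf A x t : deg A x != 1%N ->
  contrib A x t = 8 - 3 * (deg A t)%:Z - 5 * #|leaves A t|%:Z.
Proof.
move=> degx; suff -> : leaves A t = leaf_nbrs A x t by [].
apply/setP=> z; rewrite in_set [RHS]in_set in_setD1.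
by have [->|] := eqVneq z x; rewrite ?(negPf degx) ?andbF.
Qed.

Lemma contrib_leaf A x t : x \in nbr A t -> deg A x = 1%N ->
  contrib A x t = 13 - 3 * (deg A t)%:Z - 5 * #|leaves A t|%:Z.
Proof.
move=> xt degx; have -> : #|leaves A t| = #|leaf_nbrs A x t|.+1.
  rewrite (cardsD1 x) in_set xt degx eqxx add1n; congr _.+1; apply: eq_card => z.
  by rewrite in_setD1 in_set [RHS]in_set in_setD1 andbA.
by rewrite /contrib; lia.
Qed.

Lemma contrib_le A x t : x \in A -> t \in nbr A x ->
  contrib A x t <= 2 + 3 * (deg A t == 1%N)%:Z.
Proof.
move=> xA tx; have := deg_gt0 (nbr_sym xA tx).
by rewrite /contrib; case: (deg A t) => [|[|k]] //=; lia.
Qed.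

Lemma sum_contrib_bound A (B : {set T}) :
  \sum_(t in B) (2 + 3 * (deg A t == 1%N)%:Z) =
  2 * #|B|%:Z + 3 * #|[set t in B | deg A t == 1%N]|%:Z.
Proof.
rewrite big_split /= sumr_const -mulr_sumr.
by rewrite (sum_indicator B (fun t => deg A t == 1%N)); lia.
Qed.

Lemma loss_le A v : v \in A -> (0 < deg A v)%N ->
  loss A v <= 8 + 2 * (deg A v)%:Z + 3 * #|leaves A v|%:Z.
Proof.
move=> vA; rewrite lt0n /loss => /negPf ->; rewrite mulr0 addr0 -[leRHS]addrA lerD2l.
rewrite -sum_contrib_bound.
by apply: ler_sum => t; apply: contrib_le.
Qed.

Lemma loss_le_nbr A v y : v \in A -> y \in nbr A v -> (1 < deg A y)%N ->
  loss A v <= 6 + 2 * (deg A v)%:Z + 3 * #|leaves A v|%:Z + contrib A v y.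
Proof.
move=> vA yv degy; have := deg_gt0 yv.
rewrite lt0n /loss => /negPf ->; rewrite mulr0 addr0 (big_setD1 y) //=.
have le_sum : \sum_(t in nbr A v :\ y) contrib A v t <=
    2 * #|nbr A v :\ y|%:Z + 3 * #|leaves A v|%:Z.
  have -> : leaves A v = [set t in nbr A v :\ y | deg A t == 1%N].
    apply/setP=> t; rewrite [LHS]in_set [RHS]in_set in_setD1.
    have [->|] //= := eqVneq t y; rewrite andbC.
    by case: eqP degy => // ->.
  rewrite -sum_contrib_bound.
  by apply: ler_sum => t /setD1P[_]; apply: contrib_le.
have -> : (deg A v = #|nbr A v :\ y|.+1)%N by rewrite /deg (cardsD1 y) yv.
by move: le_sum (contrib A v y); move: (\sum_(t in _ :\ y) _) => s + c; lia.
Qed.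

(** Each endpoint costs the other more than its own loss can gain: with degrees d, d' and leaf
    counts l, l', the two bounds add up to 28 - d - d' - 2l - 2l'. *)
Lemma loss_adjacent A v y : v \in A -> y \in nbr A v ->
  (1 < deg A v)%N -> (1 < deg A y)%N -> loss A v + loss A y <= 26.
Proof.
move=> vA yv degv degy; have vy := nbr_sym vA yv.
have yA : y \in A by move: yv; rewrite in_nbr => /andP[].
have := loss_le_nbr vA yv degy; have := loss_le_nbr yA vy degv.
by rewrite !contrib_nonleaf; lia.
Qed.

Lemma nbr1 A x v : v \in nbr A x -> deg A x = 1%N -> nbr A x = [set v].
Proof.
by move=> vx /eqP/cards1P[w nx]; move: vx; rewrite nx inE => /eqP ->.
Qed.

Lemma loss_leaf A x v : x \in A -> v \in nbr A x -> deg A x = 1%N ->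
  loss A x = 21 - 3 * (deg A v)%:Z - 5 * #|leaves A v|%:Z.
Proof.
move=> xA vx degx; rewrite /loss degx (nbr1 vx degx) big_set1.
by rewrite (contrib_leaf (nbr_sym xA vx) degx); lia.
Qed.

Lemma leaves_gt0 A x v : x \in A -> v \in nbr A x -> deg A x = 1%N ->
  (0 < #|leaves A v|)%N.
Proof.
move=> xA vx degx; apply/card_gt0P; exists x.
by rewrite in_set (nbr_sym xA vx) degx.
Qed.

(** * Existence of a good move for Sweller *)

(** The first clause serves when [x] ends the game; the second allows 13, half of 26, for each of
    the two moves. *)
Definition good_move A x : Prop :=
  loss A x <= 13 /\ forall y, y \in rest A x -> loss A x + loss (rest A x) y <= 26.

Lemma leaf_good_move A x v M : x \in A -> v \in nbr A x -> deg A x = 1%N ->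
  (1 < deg A v)%N ->
  (forall y, y \in A -> loss A y <= M) -> loss A x + M + 3 <= 26 ->
  (forall y, y \in nbr A v -> (1 < deg A y)%N -> loss A y <= 13) ->
  good_move A x.
Proof.
move=> xA vx degx degv leM leM26 nbr13; have lossx := loss_leaf xA vx degx.
have ge1 := leaves_gt0 xA vx degx.
split=> [|y yA']; first by lia.
have yA : y \in A by move: yA'; rewrite in_rest => /and3P[].
(* In the remaining case [y] is at distance 2, through [v]; the terms in the degree and leaves of
   [v] cancel, leaving the bound 13 + [loss A y]. *)
have := leM y yA; have [||[? _]|[p [px yp degy]]] := loss_rest xA yA'; try lia.
move: px; rewrite (nbr1 vx degx) inE => /eqP eq_pv; subst p.
have := nbr13 y yp degy; rewrite contrib_nonleaf; lia.
Qed.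

Lemma good_move_exists A : A != set0 -> exists2 x, x \in A & good_move A x.
Proof.
case/set0Pn=> v0 v0A.
have [v vA max_v] := @arg_maxP _ int T v0 (mem A) (loss A) v0A.
have {}max_v y : y \in A -> loss A y <= loss A v by apply: max_v.
have [le13|gt13] := leP (loss A v) 13.
  (* Discarding isolated vertices makes the vertex found by [exists_deg_le1] a leaf. If all vertices
     are isolated, every move loses 13. *)
  pose B := [set x in A | deg A x != 0%N].
  have [/setP B0|B0] := eqVneq B set0.
    have deg0 x : x \in A -> deg A x = 0%N.
      by move=> xA; have := B0 x; rewrite !inE xA => /eqP.
    exists v0 => //; rewrite /good_move loss_isolated ?deg0 //; split=> // y yA'.
    have yA : y \in A by move: yA'; rewrite in_rest => /and3P[].
    have := loss_isolated (deg0 y yA); have nx := cards0_eq (deg0 v0 v0A).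
    have [||[_ [p]]|[p []]] := loss_rest v0A yA'; try lia.
      by rewrite nx inE.
    by rewrite nx inE.
  have [x xB degx] := exists_deg_le1 B0.
  have [xA degx0] : x \in A /\ deg A x != 0%N by apply/andP; move: xB; rewrite inE.
  have {}degx : deg A x = 1%N.
    suff nE : nbr A x = nbr B x by move: degx degx0; rewrite /deg nE; lia.
    apply/setP=> y; rewrite !in_nbr in_set; have [xy|] := boolP (e x y); last by rewrite !andbF.
    case yA: (y \in A) => //=; rewrite -lt0n (@deg_gt0 _ _ x) //.
    by rewrite in_nbr xA e_sym.
  have /set0Pn[v' v'x] : nbr A x != set0 by rewrite -card_gt0 -/(deg A x) degx.
  have degv' := deg_gt0 (nbr_sym xA v'x).
  have lossx := loss_leaf xA v'x degx; have ge1 := leaves_gt0 xA v'x degx.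
  (* If [v'] has degree at least 2, then [x] loses at most 21 - 6 - 5 = 10, and 10 + 13 + 3 = 26.
     Otherwise [x] and [v'] form a component, with loss 13 and no effect on other vertices. *)
  exists x => //; have [degv'1|degv'2] := leqP (deg A v') 1; last first.
    apply: (leaf_good_move xA v'x degx degv'2 max_v); first by lia.
    move=> y; rewrite in_nbr => /andP[yA _] _.
    by apply: le_trans (max_v y yA) le13.
  split=> [|y yA']; first by lia.
  have yA : y \in A by move: yA'; rewrite in_rest => /and3P[].
  have := max_v y yA.
  have [le|le|[_ [p]]|[p [+ yp _ _]]] := loss_rest xA yA';
    rewrite ?(nbr1 v'x degx) ?inE.
  - by clear -le lossx degv' ge1; lia.
  - by clear -le le13 lossx degv' ge1; lia.
  - by move/eqP=> -> /leq_trans/(_ degv'1); rewrite ltnn.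
  move/eqP=> eq_p; subst p.
  have /(congr1 (fun E : {set T} => y \in E)) : nbr A v' = [set x].
    by apply: nbr1 (nbr_sym xA v'x) _; apply/eqP; rewrite eqn_leq degv'1.
  by rewrite yp inE; move: yA'; rewrite in_rest => /andP[/negPf ->].
have degv : (0 < deg A v)%N.
  by rewrite lt0n; apply: contraTneq gt13 => /loss_isolated ->.
have lossv := loss_le vA degv.
have leaves_deg : (#|leaves A v| <= deg A v)%N.
  by apply: subset_leq_card; apply/subsetP=> z; rewrite in_set => /andP[].
(* The losses of [v] and [y] add up to at most 26, and that of [v] is the larger. *)
have nbr13 y : y \in nbr A v -> (1 < deg A v)%N -> (1 < deg A y)%N -> loss A y <= 13.
  move=> yv degv2 degy; have := loss_adjacent vA yv degv2 degy.
  by have := max_v y; move: yv; rewrite in_nbr => /andP[yA _] /(_ yA); lia.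
have [/exists_inP[u uv /andP[/eqP degu lu]]|/exists_inPn no_u] :=
    boolP [exists u in nbr A v, (deg A u == 2%N) && (leaf_nbrs A v u == set0)].
  have [uA vu] : u \in A /\ e v u by apply/andP; rewrite -in_nbr.
  have vu' := nbr_sym vA uv.
  (* If [u] were the only neighbour of [v], then [v] would have no leaf and lose at most 10. *)
  have degv2 : (1 < deg A v)%N.
    have /subset_leq_card : leaves A v \subset nbr A v :\ u.
      apply/subsetP=> z; rewrite in_set in_setD1 => /andP[-> /eqP degz].
      by rewrite andbT; apply: contra_eq_neq degz => ->; rewrite degu.
    have : deg A v = #|nbr A v :\ u|.+1 by rewrite /deg (cardsD1 u) uv.
    by lia.
  have [w Nu] : exists w, nbr A u :\ v = [set w].
    by apply/cards1P; have := degu; rewrite /deg (cardsD1 v) vu' add1n => -[->].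
  have [neq_wv wu] : w != v /\ w \in nbr A u by apply/setD1P; rewrite Nu inE.
  have wA : w \in A by move: wu; rewrite in_nbr => /andP[].
  have degw : (1 < deg A w)%N.
    have := deg_gt0 (nbr_sym uA wu); have : deg A w != 1%N; last by clear; lia.
    by move/setP: (eqP lu) => /(_ w); rewrite in_set Nu !inE eqxx /= => ->.
  have lossu : loss A u = 8 + (contrib A u v + contrib A u w).
    by rewrite /loss degu (big_setD1 v) //= Nu big_set1.
  exists u => //.
  have cv : contrib A u v = 8 - 3 * (deg A v)%:Z - 5 * #|leaves A v|%:Z.
    by rewrite contrib_nonleaf // degu.
  have cw : contrib A u w = 8 - 3 * (deg A w)%:Z - 5 * #|leaves A w|%:Z.
    by rewrite contrib_nonleaf // degu.
  have lossu13 : loss A u <= 13.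
    by clear -lossu cv cw degw degv2; lia.
  (* With d the degree and l the leaf count of [v], the sum is at most 29 - d - 2l; the case d = 2,
     l = 0 is excluded, since then [v] would lose at most 12. *)
  have lossuv : loss A u + loss A v + 3 <= 26.
    by clear -lossu cv cw degw degv2 lossv gt13; lia.
  split=> // y yA'; have yA : y \in A by move: yA'; rewrite in_rest => /and3P[].
  have le_yv := max_v y yA.
  have [le|le|[le _]|[p [pu yp degy]]] := loss_rest uA yA'.
  - by clear -le lossu13; lia.
  - by clear -le le_yv lossuv; lia.
  - by clear -le le_yv lossuv; lia.
  rewrite contrib_nonleaf => [le|]; last by clear -degy; lia.
  (* The contribution of [p] to the loss of [y] cancels its contribution to that of [u]. What
     remains is bounded through [nbr13] if [p] is [v], and through the bound on [loss A v] if [p] is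
     [w]. *)
  have /orP[/eqP eq_pv|/eqP eq_pw] : (p == v) || (p == w).
  - by have [//|neq_pv] := eqVneq p v; rewrite -in_set1 -Nu in_setD1 neq_pv.
  - subst p; have := nbr13 y yp degv2 degy.
    by clear -le lossu cv cw degw; lia.
  by subst p; clear -le le_yv lossu cv cw lossv degv2; lia.
(* Non-leaf neighbours now contribute at most 0: 8 - 6 - 5 for degree 2 with a leaf, at most 8 - 9
   for higher degree. As [v] loses more than 13, it has at least two leaves. *)
have loss5 : loss A v <= 8 + 5 * #|leaves A v|%:Z.
  rewrite /loss; have /negPf -> : deg A v != 0%N by lia.
  rewrite mulr0 addr0 lerD2l -(sum_indicator (nbr A v) (fun t => deg A t == 1%N)).
  rewrite mulr_sumr; apply: ler_sum => t tv; have := no_u t tv.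
  have := deg_gt0 (nbr_sym vA tv); rewrite -cards_eq0 /contrib.
  case: (deg A t) => [|[|[|k]]] //=; lia.
have /set0Pn[x] : leaves A v != set0 by rewrite -card_gt0; lia.
rewrite in_set => /andP[xv /eqP degx].
have xA : x \in A by move: xv; rewrite in_nbr => /andP[].
have vx := nbr_sym vA xv; have lossx := loss_leaf xA vx degx.
(* With d and l as the degree and leaf count of [v], the required sum is at most 32 - d - 2l, hence
   at most 26 since d and l are at least 2. *)
exists x => //; apply: (leaf_good_move xA vx degx _ max_v); try lia.
by move=> y yv degy; apply: nbr13 => //; lia.
Qed.

(** * From good moves to the game value, and the initial potential *)

Lemma playable_rest S v : v \in playable e S ->
  playable e (v |: S) = rest (playable e S) v.
Proof.
move=> vS; apply/setP=> w; rewrite in_rest !inE negb_or.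
have [//|neq_wv] /= := eqVneq w v; case wS: (w \in S); rewrite ?andbF //=.
apply/forall_inP/andP => [nadj|[nvw /forall_inP nadj] u].
  split; first by apply: nadj; rewrite setU11.
  by apply/forall_inP=> u uS; apply: nadj; rewrite inE uS orbT.
by case/setU1P=> [->//|]; apply: nadj.
Qed.

(** Induction over rounds of two moves: a good move and Diminisher's best reply add 52 to the first
    term and destroy at most 52 of potential. *)
Lemma potential_le_game_value S :
  26 * #|S|%:Z + potential (playable e S) <= 26 * (game_value e Sweller S)%:Z.
Proof.
have [n] := ubnP #|playable e S|; elim: n S => // n IHn S le_n.
rewrite game_valueE; case: (eqVneq (playable e S) set0) => [->|A0].
  by rewrite /potential big_set0 addr0.
have [x xA [loss13 loss26]] := good_move_exists A0.
set V := \max_(v in _) _.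
have leV : (game_value e Diminisher (x |: S) <= V)%N.
  by rewrite /V (bigD1 x) //= leq_maxl.
have potx := potential_loss xA; have cardx := playable_card xA.
have eqA' := playable_rest xA.
suff : 26 * #|S|%:Z + potential (playable e S) <=
       26 * (game_value e Diminisher (x |: S))%:Z.
  by clear -leV; lia.
(* If [x] ends the game, the whole potential is twice its loss, at most 26. *)
have [A'0|A'0] := eqVneq (playable e (x |: S)) set0.
  rewrite game_valueE A'0 eqxx cardx.
  have : potential (rest (playable e S) x) = 0.
    by rewrite -eqA' A'0 /potential big_set0.
  by clear -potx loss13; lia.
have [y yA' [-> _]] := game_value_minP A'0.
have yA : y \in rest (playable e S) x by rewrite -eqA'.
have cardy := playable_card yA'; have poty := potential_loss yA.
have := loss26 y yA.
have lt_card : (#|playable e (y |: (x |: S))| < n)%N.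
  rewrite -ltnS; apply: leq_trans le_n; rewrite ltnS.
  apply: proper_card; rewrite playable_rest // eqA' properE.
  apply/andP; split; first by rewrite /rest setDDl subsetDl.
  by apply/subsetPn; exists x => //; rewrite !in_rest eqxx /= !andbF.
have := IHn _ lt_card; rewrite playable_rest // eqA'.
by clear -potx poty cardx cardy; lia.
Qed.

(* Peeling off vertices of degree at most 1; the components met by A are those of
   the whole graph, so that they need not be recomputed. *)
Lemma sum_deg_components A :
  (\sum_(x in A) deg A x + 2 * #|fingraph.root e @: A| <= 2 * #|A|)%N.
Proof.
have [n] := ubnP #|A|; elim: n A => // n IHn A le_n.
have [->|A0] := eqVneq A set0; first by rewrite big_set0 imset0 cards0.
have [x xA degx] := exists_deg_le1 A0; set B := A :\ x.
have cardA : #|A| = #|B|.+1 by rewrite (cardsD1 x) xA.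
have nbrB : nbr A x = nbr B x.
  by apply/setP=> y; rewrite !inE; have [->|] := eqVneq y x; rewrite ?e_irr ?andbF.
have degB : (\sum_(y in B) deg A y = \sum_(y in B) deg B y + deg A x)%N.
  have -> : deg A x = (\sum_(y in B) e x y)%N.
    rewrite /deg nbrB -sum1_card big_mkcond [RHS]big_mkcond /=.
    by apply: eq_bigr => y _; rewrite inE; case: (y \in B) => //=; case: (e x y).
  rewrite -big_split /=; apply: eq_bigr => y _.
  rewrite /deg (cardsD1 x) in_nbr xA e_sym addnC; congr (_ + _)%N.
  by apply: eq_card => z; rewrite !inE andbA.
(* A component disappears only if [x] is isolated in [A]: a neighbour of [x] has the same root and
   stays in [B]. *)
have imA : (#|fingraph.root e @: A| + deg A x <= #|fingraph.root e @: B| + 1)%N.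
  rewrite -(setD1K xA) -/B imsetU1; have [deg0|] := posnP (deg A x).
    rewrite (setD1K xA) deg0 addn0 addnC.
    by rewrite cardsU1 leq_add2r; case: (_ \notin _).
  rewrite (setD1K xA) => /card_gt0P[y xy]; rewrite cardsU1.
  have -> : fingraph.root e x \in fingraph.root e @: B.
    apply/imsetP; exists y; first by move: xy; rewrite nbrB in_nbr => /andP[].
    apply/eqP; rewrite root_connect; last exact: sym_connect_sym.
    by apply: connect1; move: xy; rewrite in_nbr => /andP[].
  by rewrite /= add0n leq_add2l.
have := IHn B; rewrite (big_setD1 x xA) /= -/B degB.
by move: le_n degx imA; rewrite cardA; clear; lia.
Qed.

(** The degrees sum to at most 2(n - C), so dropping the bonus for isolated vertices leaves at least
    16n - 6(n - C). *)
Lemma potential_setT :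
  10 * #|T|%:Z + 6 * (num_components e)%:Z <= potential [set: T].
Proof.
have le_comp : (num_components e <= #|fingraph.root e @: [set: T]|)%N.
  apply: subset_leq_card; apply/subsetP=> x; rewrite !inE => /andP[/eqP <- _].
  by apply: imset_f.
have := sum_deg_components [set: T]; rewrite cardsT => le_deg.
have : 16 * #|T|%:Z - 3 * (\sum_(x in [set: T]) deg [set: T] x)%N%:Z <=
    potential [set: T].
  rewrite -cardsT -sum1_card -![(\sum_(_ in _) _)%N%:Z]natz !natr_sum !mulr_sumr -sumrB.
  by apply: ler_sum => x _; rewrite /weight !natz; lia.
by move: le_deg le_comp; clear; lia.
Qed.

End Forest.

Theorem theorem4 (T : finType) (e : rel T)
  (e_sym : symmetric e) (e_irr : irreflexive e) (e_forest : acyclic e) :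
  (5 * #|T|%:R + 3 * (num_components e)%:R) / 13 <= (I_s e)%:R :> rat.
Proof.
have := potential_le_game_value e_sym e_irr e_forest set0.
have -> : playable e set0 = [set: T].
  by apply/setP=> v; rewrite !inE; apply/forall_inP => u; rewrite inE.
rewrite cards0 mulr0 add0r -/(I_s e).
move=> /(le_trans (potential_setT e_sym e_irr e_forest)) le_Is.
rewrite ler_pdivrMr // -!natrM -natrD ler_nat.
by move: le_Is; clear; lia.
Qed.
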